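(* Let $R$ be a commutative ring with identity, let $A\in M_{s\times s}(R)$ be non-singular, and let $C_1,\dots,C_s$ be linear codes of length $m$ over $R$. Then the dual of the matrix-product code $[C_1\,\dots\,C_s]\,A$ is given by $$([C_1\,\dots\,C_s]\,A)^\perp=[C_1^\perp\,\dots\,C_s^\perp]\,(A^{-1})^t.$$
   Context: $M_{s\times s}(R)$ is the set of $s\times s$ matrices over $R$; $A$ is non-singular (invertible) if $\det(A)$ is a unit of $R$; $^t$ denotes transpose. A linear code of length $m$ over $R$ is an $R$-submodule of $R^m$. With $\langle x,y\rangle=\sum_{k} x_ky_k$, the dual of a linear code $C\subseteq R^m$ is $C^\perp=\{x\in R^m : \langle x,c\rangle=0 \text{ for all } c\in C\}$. For linear codes $C_1,\dots,C_s$ of length $m$ and $A=(a_{i,j})\in M_{s\times s}(R)$, the matrix-product code is $[C_1\,\dots\,C_s]\,A=\{(c_1\,\dots\,c_s)A : c_i\in C_i\}$, where $(c_1\,\dots\,c_s)$ is the $m\times s$ matrix whose $i$th column is $c_i$. It is viewed as a linear code of length $ms$ by identifying an $m\times s$ matrix with the concatenation of its columns, so its codewords are $\left(\sum_{i=1}^s a_{i,1}c_i,\dots,\sum_{i=1}^s a_{i,s}c_i\right)$ with $c_i\in C_i$. *)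

(* Defs.v *)
From mathcomp Require Import all_boot all_algebra.
From mathcomp Require Import boolp classical_sets.

Set Implicit Arguments.
Unset Strict Implicit.
Unset Printing Implicit Defensive.

Import GRing.Theory.

Local Open Scope classical_set_scope.
Local Open Scope ring_scope.

(* MathComp's unitmx and invmx live over a comUnitRingType, which rules out the
   zero ring and carries a choice of inverses. The two notions below only need
   a commutative ring with identity; nonsingularE and mxinvE show that they
   agree with unitmx and invmx where both make sense. *)
Definition nonsingular (R : comPzRingType) (s : nat) (A : 'M[R]_s) : Prop :=
  exists u : R, \det A * u = 1.

(* The value on singular matrices is the arbitrary default 0. *)
Definition mxinv (R : comPzRingType) (s : nat) (A : 'M[R]_s) : 'M[R]_s :=
  xget 0 [set B : 'M[R]_s | A *m B = 1%:M /\ B *m A = 1%:M].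

Lemma mxinvP (R : comPzRingType) (s : nat) (A : 'M[R]_s) :
  nonsingular A -> A *m mxinv A = 1%:M /\ mxinv A *m A = 1%:M.
Proof.
move=> [u du].
apply: (@xgetPex _ 0 [set B : 'M[R]_s | A *m B = 1%:M /\ B *m A = 1%:M]).
exists (u *: \adj A) => /=.
have h : A *m (u *: \adj A) = 1%:M.
  by rewrite -scalemxAr mul_mx_adj scale_scalar_mx mulrC du.
by split=> //; exact: mulmx1C.
Qed.

Lemma nonsingularE (R : comUnitRingType) (s : nat) (A : 'M[R]_s) :
  nonsingular A <-> A \in unitmx.
Proof.
rewrite unitmxE; split=> [[u du]|/mulrV du]; last by exists (\det A)^-1.
by apply/unitrPr; exists u.
Qed.

Lemma mxinvE (R : comUnitRingType) (s : nat) (A : 'M[R]_s) :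
  A \in unitmx -> mxinv A = invmx A.
Proof.
move=> uA; have [AB _] := mxinvP ((nonsingularE A).2 uA).
by rewrite -[LHS]mul1mx -(mulVmx uA) -mulmxA AB mulmx1.
Qed.

Definition linear_code (R : comPzRingType) (n : nat) (C : set 'rV[R]_n) : Prop :=
  GRing.submod_closed (mem C).

Definition inner (R : comPzRingType) (n : nat) (x y : 'rV[R]_n) : R :=
  \sum_(k < n) x 0 k * y 0 k.

Definition dual (R : comPzRingType) (n : nat) (C : set 'rV[R]_n) :
    set 'rV[R]_n :=
  [set x | forall c, C c -> inner x c = 0].

Definition cols_mx (R : comPzRingType) (m s : nat) (c : 'I_s -> 'rV[R]_m) :
    'M[R]_(m, s) :=
  \matrix_(k < m, i < s) c i 0 k.

(* mxvec concatenates rows, so the concatenation of the columns of M is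
   mxvec M^T, whose length is s * m. *)
Definition matrix_product_code (R : comPzRingType) (m s : nat)
    (C : 'I_s -> set 'rV[R]_m) (A : 'M[R]_s) : set 'rV[R]_(s * m) :=
  [set mxvec (cols_mx c *m A)^T | c in [set c | forall i : 'I_s, C i (c i)]].

(* Main.v *)
(* Under mxvec the inner product is the trace form tr (X Y^T), so cyclicity of
   the trace gives <[d] (A^-1)^T, [c] A> = tr (A A^-1 [d]^T [c]) =
   \sum_i <d_i, c_i>; testing a word of the dual against families [c]
   concentrated at one index recovers each condition d_i \in C_i^\perp. *)
Require Import Defs.
From mathcomp Require Import all_boot all_algebra.
From mathcomp Require Import boolp classical_sets.

Local Open Scope ring_scope.

Lemma inner_mxvec (R : comPzRingType) (s m : nat) (X Y : 'M[R]_(s, m)) :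
  inner (mxvec X) (mxvec Y) = \tr (X *m Y^T).
Proof.
rewrite /inner (reindex _ (curry_mxvec_bij s m)) /=.
rewrite (eq_bigr (fun p => X p.1 p.2 * Y p.1 p.2)) => [|[i j] _]; last first.
  by rewrite /= !mxvecE.
rewrite -(pair_bigA _ (fun i j => X i j * Y i j)) /=.
apply: eq_bigr => i _; rewrite mxE.
by apply: eq_bigr => j _; rewrite mxE.
Qed.

Lemma mxtrace_mul_cols_mx (R : comPzRingType) (s m : nat) (X : 'M[R]_(s, m))
    (c : 'I_s -> 'rV[R]_m) :
  \tr (X *m cols_mx c) = \sum_i inner (row i X) (c i).
Proof.
apply: eq_bigr => i _; rewrite mxE.
by apply: eq_bigr => k _; rewrite !mxE.
Qed.

(** Cyclicity of the trace moves [A] from the codeword onto [X], so orthogonality to the product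
    code becomes a condition pairing each row of [A *m X] with one [c i]. *)
Lemma inner_mxvec_cols_mx (R : comPzRingType) (s m : nat) (X : 'M[R]_(s, m))
    (c : 'I_s -> 'rV[R]_m) (A : 'M[R]_s) :
  inner (mxvec X) (mxvec (cols_mx c *m A)^T) =
  \sum_i inner (row i (A *m X)) (c i).
Proof.
by rewrite inner_mxvec trmxK mulmxA mxtrace_mulC mulmxA mxtrace_mul_cols_mx.
Qed.

Lemma inner0r (R : comPzRingType) (n : nat) (x : 'rV[R]_n) : inner x 0 = 0.
Proof. by apply: big1 => k _; rewrite mxE GRing.mulr0. Qed.

Lemma cols_mx_row (R : comPzRingType) (s m : nat) (X : 'M[R]_(s, m)) :
  cols_mx (fun i => row i X) = X^T.
Proof. by apply/matrixP => i j; rewrite !mxE. Qed.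

Lemma row_cols_mx (R : comPzRingType) (s m : nat) (c : 'I_s -> 'rV[R]_m) i :
  row i (cols_mx c)^T = c i.
Proof. by apply/rowP => k; rewrite !mxE. Qed.

Theorem theorem3p3 (R : comPzRingType) (m s : nat) (A : 'M[R]_s)
    (C : 'I_s -> set 'rV[R]_m)
    (hA : nonsingular A) (hC : forall i : 'I_s, linear_code (C i)) :
  dual (matrix_product_code C A) =
  matrix_product_code (fun i : 'I_s => dual (C i)) (mxinv A)^T.
Proof.
have [AB BA] := mxinvP hA.
apply/seteqP; split=> [x dx|_ [d dC <-] _ [c cC <-]]; last first.
  rewrite inner_mxvec_cols_mx trmx_mul trmxK mulmxA AB mul1mx.
  by apply: big1 => i _; rewrite row_cols_mx; exact: dC.
(* Solving [mxinv A *m (cols_mx d)^T = vec_mx x] for [d] forces this choice. *)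
exists (fun i => row i (A *m vec_mx x)); last first.
  by rewrite cols_mx_row -trmx_mul trmxK mulmxA BA mul1mx vec_mxK.
move=> i c cC /=.
pose e j : 'rV[R]_m := if j == i then c else 0.
have eC j : C j (e j).
  rewrite /e; case: eqP => [->//|_].
  (* Off index [i] the family is zero, and a submodule contains 0. *)
  by have [+ _] := hC j => /set_mem.
have /dx : matrix_product_code C A (mxvec (cols_mx e *m A)^T) by exists e.
(* Only the [i]-th term survives, and it is the required inner product with [c]. *)
rewrite -{1}(vec_mxK x) inner_mxvec_cols_mx (bigD1 i) //= /e eqxx.
rewrite big1 ?GRing.addr0 // => j /negbTE ->.
exact: inner0r.
Qed.
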